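(* Let $(f_n)_{n \in \mathbb{N}}$ be a sequence of measurable real-valued functions on a measure space $(X, \mathcal{B}, \mu)$, and let $\mathsf{AU}$, $\mathsf{AUM}$, $\mathsf{AE}$ denote, respectively, almost uniform convergence, almost uniform metastable pointwise convergence, and pointwise a.e. convergence of $(f_n)$ (each in the Cauchy form). \begin{enumerate} \item $\mathsf{AU}$ implies $\mathsf{AUM}$, and $\mathsf{AUM}$ implies $\mathsf{AE}$. (Hence, if $(X,\mathcal{B},\mu)$ is a probability space or the sequence $(f_n)$ is dominated by an $L^p$ function for some $1 \leq p < \infty$, the three notions coincide.) \item If $\mu(\{x : |f_n(x) - f_{n'}(x)| \geq \varepsilon\}) < \infty$ for all $\varepsilon > 0$, $n$, and $n'$, then $\mathsf{AE}$ implies $\mathsf{AUM}$. (In particular, the conclusion holds if for some $1 \leq p < \infty$, $f_n \in L^p$ for every $n$.) \item In general, the implications in (1) do not reverse: there exist a measure space and a sequence of measurable functions on it satisfying $\mathsf{AUM}$ but not $\mathsf{AU}$, and there exist a measure space and a sequence of measurable functions on it satisfying $\mathsf{AE}$ but not $\mathsf{AUM}$. \end{enumerate}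
   Context: The measure space is arbitrary (not assumed finite or $\sigma$-finite). For natural numbers $m, k$, $[m,k]$ denotes $\{n \in \mathbb{N} : m \leq n \leq k\}$ (empty if $k < m$). The modes of convergence of a sequence $(f_n)$ are: $\mathsf{AE}$: for almost every $x$, for every $\varepsilon > 0$ there is $m$ such that $|f_n(x) - f_{n'}(x)| < \varepsilon$ for all $n, n' \geq m$. $\mathsf{AU}$: for every $\lambda > 0$ and $\varepsilon > 0$ there is $m$ such that \[ \mu(\{x : \exists n, n' \geq m\ |f_n(x) - f_{n'}(x)| \geq \varepsilon\}) < \lambda. \] $\mathsf{AUM}$: for every $\lambda > 0$, $\varepsilon > 0$, and $F : \mathbb{N} \to \mathbb{N}$ there is $M \in \mathbb{N}$ such that \[ \mu(\{x : \forall m \leq M\ \exists n, n' \in [m,F(m)]\ |f_n(x) - f_{n'}(x)| \geq \varepsilon\}) < \lambda. \] The sequence $(f_n)$ is dominated by a function $g$ if $|f_n| \leq g$ for every $n$. *)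

(* Defs.v *)
From mathcomp Require Import all_boot all_order all_algebra.
From mathcomp Require Import all_classical all_reals all_analysis.

Set Implicit Arguments.
Unset Strict Implicit.
Unset Printing Implicit Defensive.

Import Order.TTheory GRing.Theory Num.Theory.
Import numFieldNormedType.Exports.

Local Open Scope classical_set_scope.
Local Open Scope ring_scope.

Definition ae_cvg (R : realType) (d : measure_display) (T : measurableType d)
    (mu : {measure set T -> \bar R}) (f : nat -> T -> R) : Prop :=
  {ae mu, forall x, forall e : R, 0 < e ->
    exists m : nat, forall n n' : nat, (m <= n)%N -> (m <= n')%N ->
      `|f n x - f n' x| < e}.

Definition almost_uniform_cvg (R : realType) (d : measure_display)
    (T : measurableType d) (mu : {measure set T -> \bar R})
    (f : nat -> T -> R) : Prop :=
  forall l e : R, 0 < l -> 0 < e ->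
    exists m : nat,
      (mu [set x : T | exists n n' : nat,
             [/\ (m <= n)%N, (m <= n')%N & (e <= `|f n x - f n' x|)%R]]
       < l%:E)%E.

(* The interval [m, F m] is empty when F m < m, in which case the set below
   is empty as soon as m <= M. *)
Definition almost_uniform_metastable_cvg (R : realType) (d : measure_display)
    (T : measurableType d) (mu : {measure set T -> \bar R})
    (f : nat -> T -> R) : Prop :=
  forall (l e : R) (F : nat -> nat), 0 < l -> 0 < e ->
    exists M : nat,
      (mu [set x : T | forall m : nat, (m <= M)%N ->
             exists n n' : nat,
               [/\ (m <= n <= F m)%N, (m <= n' <= F m)%N &
                   (e <= `|f n x - f n' x|)%R]]
       < l%:E)%E.

Definition seq_dominated (R : realType) (T : Type) (f : nat -> T -> R)
    (g : T -> R) : Prop :=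
  forall n x, `|f n x| <= g x.

(* Main.v *)
Require Import Defs.
From mathcomp Require Import all_boot all_order all_algebra.
From mathcomp Require Import all_classical all_reals all_analysis.
From mathcomp Require Import measurable_realfun.

Set Implicit Arguments.
Unset Strict Implicit.
Unset Printing Implicit Defensive.

Import Order.TTheory GRing.Theory Num.Theory.
Import numFieldNormedType.Exports.

Local Open Scope classical_set_scope.
Local Open Scope ring_scope.

(** Write [tail_gap e m] for the set of points at which two terms with indices
at least [m] differ by at least [e]. These sets decrease in [m], and their
intersections over [m], for all [e], make up the set of divergence: almost
everywhere convergence says that each intersection is null ([ae_cvgP]), almost
uniform convergence that the measures of the tails tend to 0. Metastability
concerns the smaller sets [unstable_upto e F M], the points at which all
windows [[m, F m]], [m <= M], contain a gap.

Almost uniform convergence implies metastability by inclusion of these sets. If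
the sequence is metastable but the divergence set for some [e] has positive
measure, one picks a real number [l > 0] below that measure and chooses the
values [F m] one by one so large that the points of divergence having a gap in
all windows so far still have measure above [l]. Each choice is possible by
continuity from below ([exists_large_measure]), because a point of divergence
has a gap in every window that is long enough ([exists_unstable_upto]).

The converse implications are continuity from above ([exists_small_measure]),
which needs one set of finite measure. For metastability this is a finite union
of gaps between two terms ([ae_cvg_metastable]), finite by Markov's inequality
for functions in Lp; for almost uniform convergence it is the whole first tail
([ae_cvg_almost_uniform]), finite in a probability space or under domination.

Without finiteness the converses fail for the counting measure on the natural
numbers: a bump moving to infinity is metastable, as any two of its terms
differ at two points only, but its tails are infinite; a sequence that
alternates at [x] until time [x] converges pointwise, but is unstable at some
point for any number of windows [[m, m + 1]]. *)

(** * Continuity of a measure along monotone sequences *)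

Section ContinuityOfMeasure.
Context {R : realType} {d : measure_display} {T : measurableType d}.
Variable mu : {measure set T -> \bar R}.

(** Continuity from above. All hypotheses that strengthen almost everywhere
convergence serve to make the first set of such a sequence finite. *)
Lemma exists_small_measure (A : nat -> set T) (l : R) :
  (forall m, measurable (A m)) -> nonincreasing_seq A ->
  (mu (A 0%N) < +oo)%E -> mu (\bigcap_m A m) = 0%E -> 0 < l ->
  exists m, (mu (A m) < l%:E)%E.
Proof.
move=> mA niA A0fin capA l0; apply: contrapT => /forallNP big.
have mcap : measurable (\bigcap_m A m) by exact: bigcap_measurableType.
have cvgA := nonincreasing_cvg_mu A0fin mA mcap niA.
have : (l%:E <= limn (mu \o A))%E.
  apply: lime_ge; first exact: cvgP cvgA.
  by apply: nearW => m; rewrite /= leNgt; apply/negP/big.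
by rewrite (cvg_lim _ cvgA)// capA lee_fin leNgt l0.
Qed.

(** Continuity from below holds for sets of infinite measure as well, which is why
metastability implies almost everywhere convergence on every measure space. *)
Lemma exists_large_measure (A : nat -> set T) (l : R) :
  (forall m, measurable (A m)) -> nondecreasing_seq A ->
  (l%:E < mu (\bigcup_m A m))%E -> exists m, (l%:E < mu (A m))%E.
Proof.
move=> mA ndA lA; apply: contrapT => /forallNP small.
have cvgA := nondecreasing_cvg_mu (mu := mu) mA (bigcupT_measurable A mA) ndA.
have : (limn (mu \o A) <= l%:E)%E.
  apply: lime_le; first exact: cvgP cvgA.
  by apply: nearW => m; rewrite /= leNgt; apply/negP/small.
by rewrite (cvg_lim _ cvgA)// leNgt lA.
Qed.

End ContinuityOfMeasure.

(** * Oscillation sets *)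

Section Oscillation.
Context {R : realType} {d : measure_display} {T : measurableType d}.
Variables (mu : {measure set T -> \bar R}) (f : nat -> T -> R).

Definition tail_gap (e : R) (m : nat) : set T :=
  [set x | exists n n' : nat,
     [/\ (m <= n)%N, (m <= n')%N & (e <= `|f n x - f n' x|)%R]].

(** The finitary part of [tail_gap]: for a fixed left end these sets increase with
[k] to the tail set, see [tail_gap_window]. *)
Definition window_gap (e : R) (m k : nat) : set T :=
  [set x | exists n n' : nat,
     [/\ (m <= n <= k)%N, (m <= n' <= k)%N & (e <= `|f n x - f n' x|)%R]].

(** Metastability says that these sets, which decrease in [M], become arbitrarily
small for every [F]. *)
Definition unstable_upto (e : R) (F : nat -> nat) (M : nat) : set T :=
  [set x | forall m, (m <= M)%N -> window_gap e m (F m) x].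

Hypothesis mf : forall n, measurable_fun [set: T] (f n).

Lemma measurable_gap (e : R) n n' :
  measurable [set x | e <= `|f n x - f n' x|].
Proof.
rewrite -[X in measurable X]setTI; apply: measurable_fun_le => //.
apply: measurableT_comp => //; exact: measurable_funB.
Qed.

Lemma measurable_exists_gap (e : R) (P : nat -> nat -> Prop) :
  measurable [set x | exists n n', P n n' /\ e <= `|f n x - f n' x|].
Proof.
rewrite (_ : mkset _ = \bigcup_n \bigcup_(n' in P n)
    [set x | e <= `|f n x - f n' x|]); last first.
  apply/seteqP; split => x /=.
    by move=> [n [n' [Pnn' le_e]]]; exists n => //; exists n'.
  by move=> [n _ [n' Pnn' le_e]]; exists n, n'.
apply: bigcup_measurable => n _; apply: bigcup_measurable => n' _.
exact: measurable_gap.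
Qed.

Lemma measurable_tail_gap e m : measurable (tail_gap e m).
Proof.
rewrite (_ : tail_gap e m = [set x | exists n n',
    ((m <= n)%N /\ (m <= n')%N) /\ e <= `|f n x - f n' x|]).
  exact: measurable_exists_gap.
apply/seteqP; split => x /=.
  by move=> [n [n' [? ? ?]]]; exists n, n'.
by move=> [n [n' [[? ?] ?]]]; exists n, n'.
Qed.

Lemma measurable_window_gap e m k : measurable (window_gap e m k).
Proof.
rewrite (_ : window_gap e m k = [set x | exists n n',
    ((m <= n <= k)%N /\ (m <= n' <= k)%N) /\ e <= `|f n x - f n' x|]).
  exact: measurable_exists_gap.
apply/seteqP; split => x /=.
  by move=> [n [n' [? ? ?]]]; exists n, n'.
by move=> [n [n' [[? ?] ?]]]; exists n, n'.
Qed.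

Lemma measurable_unstable_upto e F M : measurable (unstable_upto e F M).
Proof.
rewrite (_ : unstable_upto e F M =
    \bigcap_(m in [set m | (m <= M)%N]) window_gap e m (F m)) //.
by apply: bigcap_measurableType => m _; exact: measurable_window_gap.
Qed.

Lemma tail_gap_window e m : tail_gap e m = \bigcup_k window_gap e m k.
Proof.
apply/seteqP; split => x.
  move=> [n [n' [mn mn' le_e]]]; exists (maxn n n') => //.
  by exists n, n'; rewrite mn mn' leq_maxl leq_maxr.
move=> [k _ [n [n' [/andP[mn _] /andP[mn' _] le_e]]]].
by exists n, n'.
Qed.

Lemma subset_window_tail e m k : window_gap e m k `<=` tail_gap e m.
Proof. by rewrite tail_gap_window; exact: bigcup_sup. Qed.

Lemma window_gapS e m k k' : (k <= k')%N ->
  window_gap e m k `<=` window_gap e m k'.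
Proof.
move=> kk' x [n [n' [/andP[mn nk] /andP[mn' n'k] le_e]]].
by exists n, n'; rewrite mn mn' (leq_trans nk kk') (leq_trans n'k kk').
Qed.

Lemma tail_gap_nonincreasing e : nonincreasing_seq (tail_gap e).
Proof.
move=> m m' mm'; rewrite subsetEset => x [n [n' [mn mn' le_e]]].
by exists n, n'; rewrite (leq_trans mm' mn) (leq_trans mm' mn').
Qed.

Lemma unstable_upto_nonincreasing e F : nonincreasing_seq (unstable_upto e F).
Proof.
move=> M M' MM'; rewrite subsetEset => x H m mM.
exact: H (leq_trans mM MM').
Qed.

(** Every [e > 0] exceeds some [1 / (k + 1)], so the points of divergence form a
countable union of sets [\bigcap_m tail_gap e m]. These are measurable, which
turns negligibility into the vanishing of their measure. *)
Lemma ae_cvgP :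
  ae_cvg mu f <-> forall e : R, 0 < e -> mu (\bigcap_m tail_gap e m) = 0%E.
Proof.
have mtail e : measurable (\bigcap_m tail_gap e m).
  by apply: bigcap_measurableType => m _; exact: measurable_tail_gap.
split=> [cvgf e e0|tail0].
  apply: measure_negligible => //; apply: negligibleS cvgf => x gapx /= cvgx.
  have [m small] := cvgx e e0.
  have [n [n' [mn mn']]] := gapx m I.
  by rewrite leNgt small.
have : mu.-negligible (\bigcup_k \bigcap_m tail_gap k.+1%:R^-1 m).
  apply: negligible_bigcup => k; apply/negligibleP => //.
  by apply: tail0; rewrite invr_gt0.
apply: negligibleS => x /= /existsNP[e /not_implyP[e0 ncvg]].
have [k ke] : exists k : nat, k.+1%:R^-1 < e.
  by near \oo => k; exists k; near: k; exact: (near_infty_natSinv_lt (PosNum e0)).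
exists k => // m _; apply: contrapT => ngap; apply: ncvg; exists m => n n' mn mn'.
rewrite ltNge; apply/negP => le_e; apply: ngap.
by exists n, n'; split=> //; exact: le_trans (ltW ke) le_e.
Unshelve. all: by end_near.
Qed.

(** A point at which the window starting at [M] is unstable has a gap beyond [M],
so the index given by almost uniform convergence serves for every [F]. *)
Lemma almost_uniform_metastable :
  almost_uniform_cvg mu f -> almost_uniform_metastable_cvg mu f.
Proof.
move=> cvgf l e F l0 e0; have [M tailM] := cvgf l e l0 e0.
exists M; apply: le_lt_trans tailM; apply: le_measure; rewrite ?inE.
- exact: measurable_unstable_upto.
- exact: measurable_tail_gap.
- by move=> x /(_ M (leqnn M)); exact: subset_window_tail.
Qed.

Lemma exists_window (e l : R) (C : set T) (m : nat) :
  measurable C -> C `<=` tail_gap e m -> (l%:E < mu C)%E ->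
  exists k, (l%:E < mu (C `&` window_gap e m k))%E.
Proof.
move=> mC Ctail lC; apply: exists_large_measure => [k|k k' kk'|].
- by apply: measurableI => //; exact: measurable_window_gap.
- by rewrite subsetEset; apply: setIS; exact: window_gapS.
- by rewrite -setI_bigcupr -tail_gap_window (setIidl Ctail).
Qed.

(** Windows of sufficient length can be chosen one after the other, each of them
losing so little of the divergence set that the measure stays above [l]: the
part left over lies in every [tail_gap e m], and this tail is exhausted by its
finite windows. *)
Lemma exists_unstable_upto (e l : R) :
  (l%:E < mu (\bigcap_m tail_gap e m))%E ->
  exists F : nat -> nat, forall M, (l%:E < mu (unstable_upto e F M))%E.
Proof.
set B := \bigcap_m _ => lB.
have mB : measurable B.
  by apply: bigcap_measurableType => m _; exact: measurable_tail_gap.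
pose good (C : set T) := [/\ measurable C, C `<=` B & (l%:E < mu C)%E].
have /choice[k kP] : forall Cm : set T * nat, exists k, good Cm.1 ->
    (l%:E < mu (Cm.1 `&` window_gap e Cm.2 k))%E.
  move=> [C m]; have [[mC CB lC]|?] := pselect (good C); last by exists 0%N.
  have Ctail : C `<=` tail_gap e m by move=> x /CB; exact.
  by have [k ?] := exists_window mC Ctail lC; exists k.
(* [D m] is what remains of [B] after the windows starting before [m]. *)
pose D := fix D m := if m is m'.+1
  then D m' `&` window_gap e m' (k (D m', m')) else B.
have goodD m : good (D m).
  elim: m => [|m [mD DB lD]] /=; first by split.
  split; first by apply: measurableI => //; exact: measurable_window_gap.
  - by move=> x [/DB].
  - exact: (kP (D m, m)).
exists (fun m => k (D m, m)) => M.
have [mD _ lD] := goodD M.+1.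
apply: lt_le_trans lD _; apply: le_measure; rewrite ?inE //.
  exact: measurable_unstable_upto.
elim: M {mD} => [|M IH] x Dx m.
  by rewrite leqn0 => /eqP ->; case: Dx.
rewrite leq_eqVlt => /predU1P[->|mM]; first by case: Dx.
by apply: IH => //; case: Dx.
Qed.

(** If the divergence set had positive measure, a real [l] below that measure and
the windows of [exists_unstable_upto] would contradict metastability. Taking
[l] strictly below the measure also covers a divergence set of infinite
measure, even one without subsets of finite positive measure. *)
Lemma metastable_ae_cvg : almost_uniform_metastable_cvg mu f -> ae_cvg mu f.
Proof.
move=> metaf; apply/ae_cvgP => e e0; apply/eqP/negPn/negP => B0.
set B := \bigcap_m _ in B0.
have [l l0 lB] : exists2 l : R, 0 < l & (l%:E < mu B)%E.
  have : (0 < mu B)%E by rewrite lt0e B0 measure_ge0.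
  case: (mu B) => [r||//]; last by exists 1; rewrite ?ltry.
  rewrite lte_fin => r0; exists (r / 2); first by rewrite divr_gt0.
  by rewrite lte_fin ltr_pdivrMr// ltr_pMr// ltr1n.
have [F unstF] := exists_unstable_upto lB.
have [M] := metaf l e F l0 e0.
by apply/negP; rewrite -leNgt ltW //; exact: unstF.
Qed.

(** The sets [unstable_upto e F M] decrease to a subset of the divergence set, and
the first of them is covered by the finitely many gaps between indices up to
[F 0], hence has finite measure. *)
Lemma ae_cvg_metastable :
  (forall (e : R) n n', 0 < e ->
     (mu [set x | (e <= `|f n x - f n' x|)%R] < +oo)%E) ->
  ae_cvg mu f -> almost_uniform_metastable_cvg mu f.
Proof.
move=> gapfin /ae_cvgP tail0 l e F l0 e0.
apply: (exists_small_measure (A := unstable_upto e F)) => //.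
- exact: measurable_unstable_upto.
- exact: unstable_upto_nonincreasing.
- pose fin_meas (A : set T) := measurable A /\ (mu A < +oo)%E.
  pose G := \big[setU/set0]_(n < (F 0%N).+1) \big[setU/set0]_(n' < (F 0%N).+1)
    [set x | e <= `|f n x - f n' x|].
  have finU A B : fin_meas A -> fin_meas B -> fin_meas (A `|` B).
    move=> [mA Afin] [mB Bfin]; split; first exact: measurableU.
    by apply: le_lt_trans (measureU2 _ mA mB) _; exact: lte_add_pinfty.
  have fin0 : fin_meas set0 by split; rewrite ?measure0.
  have [mG Gfin] : fin_meas G.
    apply: (big_ind fin_meas) => // n _; apply: (big_ind fin_meas) => // n' _.
    by split; [exact: measurable_gap|exact: gapfin].
  apply: le_lt_trans Gfin; apply: le_measure; rewrite ?inE //.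
    exact: measurable_unstable_upto.
  move=> x /(_ 0%N isT)[n [n' [/andP[_ nF] /andP[_ n'F] le_e]]].
  rewrite /G -(bigcup_mkord _ (fun n => \big[setU/set0]_(n' < _)
    [set x | e <= `|f n x - f n' x|])); exists n => //.
  by rewrite -(bigcup_mkord _ (fun n' => [set x | e <= `|f n x - f n' x|]));
    exists n'.
- apply/eqP; rewrite eq_le measure_ge0 andbT -(tail0 e e0).
  apply: le_measure; rewrite ?inE.
  + by apply: bigcap_measurableType => M _; exact: measurable_unstable_upto.
  + by apply: bigcap_measurableType => m _; exact: measurable_tail_gap.
  + move=> x unstx m _; apply: subset_window_tail.
    exact: (unstx m I m (leqnn m)).
Qed.

(** The argument of Egorov's theorem: the tails decrease to the divergence set. *)
Lemma ae_cvg_almost_uniform :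
  (forall e : R, 0 < e -> (mu (tail_gap e 0%N) < +oo)%E) ->
  ae_cvg mu f -> almost_uniform_cvg mu f.
Proof.
move=> tailfin /ae_cvgP tail0 l e l0 e0.
apply: (exists_small_measure (A := tail_gap e)) => //.
- exact: measurable_tail_gap.
- exact: tail_gap_nonincreasing.
- exact: tailfin.
- exact: tail0.
Qed.

End Oscillation.

(** * Finiteness of the gap sets of Lp functions *)

Section Lp.
Context {R : realType} {d : measure_display} {T : measurableType d}.
Context {mu : {measure set T -> \bar R}} {p : R} (p1 : 1 <= p).

Lemma measurable_superlevel (g : T -> R) (e : R) :
  measurable_fun [set: T] g -> measurable [set x | e <= `|g x|].
Proof.
move=> mg; rewrite -[X in measurable X]setTI.
by apply: measurable_fun_le => //; exact: measurableT_comp.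
Qed.

Lemma Lfun_measurable (g : T -> R) :
  g \in Lfun mu p%:E -> measurable_fun [set: T] g.
Proof. by move/sub_Lfun_mfun; rewrite inE. Qed.

(** Markov's inequality for the integrable function [`|g| `^ p]. *)
Lemma Lfun_superlevel_lty (g : T -> R) (e : R) :
  g \in Lfun mu p%:E -> 0 < e -> (mu [set x | (e <= `|g x|)%R] < +oo)%E.
Proof.
move=> gp e0; have intg := Lfun_integrable p1 gp.
have [mgp fin_gp] := integrableP _ _ _ intg.
have ep0 : 0 < e `^ p by rewrite powR_gt0.
have := le_lt_trans (le_integral_abse mu measurableT mgp ep0) fin_gp.
rewrite setTI => markov.
have sub : [set x | e <= `|g x|] `<=`
    [set x | ((e `^ p)%:E <= `|(`|g x| `^ p)%:E|)%E].
  move=> x /= eg; rewrite lee_fin ger0_norm ?powR_ge0//.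
  by rewrite ge0_ler_powR// ?nnegrE ?(ltW e0)// (le_trans ler01).
have mgpset : measurable [set x | ((e `^ p)%:E <= `|(`|g x| `^ p)%:E|)%E].
  rewrite -[X in measurable X]setTI; apply: emeasurable_fun_c_infty => //.
  exact: measurableT_comp.
apply: le_lt_trans (le_measure mu _ _ sub) _; rewrite ?inE//.
  exact: measurable_superlevel (Lfun_measurable gp).
rewrite ltNge leye_eq; apply/negP => /eqP muoo.
by move: markov; rewrite muoo gt0_muley ?lte_fin.
Qed.

(** Applied pointwise, this covers the gap between two functions by a superlevel
set of each. *)
Lemma ler_dist_half (a b e : R) : e <= `|a - b| -> e / 2 <= `|a| \/ e / 2 <= `|b|.
Proof.
move=> le_e; have [|lt_a] := leP (e / 2) `|a|; first by left.
right; rewrite leNgt; apply/negP => lt_b; move: le_e; apply/negP.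
by rewrite -ltNge (le_lt_trans (ler_normB _ _))// [e]splitr ltrD.
Qed.

Lemma Lfun_gap_lty (g h : T -> R) (e : R) :
  g \in Lfun mu p%:E -> h \in Lfun mu p%:E -> 0 < e ->
  (mu [set x | (e <= `|g x - h x|)%R] < +oo)%E.
Proof.
move=> gp hp e0; have e20 : 0 < e / 2 by rewrite divr_gt0.
have [mg mh] := (Lfun_measurable gp, Lfun_measurable hp).
have msup (k : T -> R) : measurable_fun [set: T] k ->
  measurable [set x | e / 2 <= `|k x|] by exact: measurable_superlevel.
apply: (@le_lt_trans _ _ (mu ([set x | e / 2 <= `|g x|] `|`
                              [set x | e / 2 <= `|h x|]))).
  apply: le_measure; rewrite ?inE.
  - by apply: (@measurable_superlevel (fun x => g x - h x));
      exact: measurable_funB.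
  - by apply: measurableU; exact: msup.
  - by move=> x /=; exact: ler_dist_half.
apply: le_lt_trans (measureU2 _ (msup _ mg) (msup _ mh)) _.
by apply: lte_add_pinfty; exact: Lfun_superlevel_lty.
Qed.

(** The bound is uniform in the indices: any gap forces [e / 2 <= g], so a single
superlevel set of [g] contains the whole tail. *)
Lemma Lfun_dominated_tail_lty (f : nat -> T -> R) (g : T -> R) (e : R) :
  (forall n, measurable_fun [set: T] (f n)) ->
  g \in Lfun mu p%:E -> seq_dominated f g -> 0 < e ->
  (mu (tail_gap f e 0%N) < +oo)%E.
Proof.
move=> mf gp fg e0; have e20 : 0 < e / 2 by rewrite divr_gt0.
apply: le_lt_trans (Lfun_superlevel_lty gp e20); apply: le_measure; rewrite ?inE.
- exact: measurable_tail_gap.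
- exact: measurable_superlevel (Lfun_measurable gp).
- move=> x [n [n' [_ _ /ler_dist_half ge]]] /=; apply: le_trans (ler_norm _).
  by case: ge => /le_trans; apply; exact: fg.
Qed.

End Lp.

(** * Counterexamples for the counting measure on the natural numbers *)

Section CountingOnNat.
Context {R : realType}.
Notation card := (counting : {measure set nat -> \bar R}).

Lemma counting_ge1 (A : set nat) : A !=set0 -> (1 <= card A)%E.
Proof.
move=> [x Ax]; rewrite -[leLHS](_ : card [set x] = 1%E); last first.
  by rewrite /= /counting asboolT// fset_set1 finmap.cardfs1.
by apply: le_measure; rewrite ?inE// => _ ->.
Qed.

Lemma counting_lty (A : set nat) : finite_set A -> (card A < +oo)%E.
Proof. by move=> finA; rewrite /= /counting asboolT// ltry. Qed.

Lemma pointwise_ae_cvg (f : nat -> nat -> R) :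
  (forall x, exists m, forall n, (m <= n)%N -> f n x = 0) -> ae_cvg card f.
Proof.
move=> f0; apply: aeW => x e e0; have [m fm] := f0 x.
by exists m => n n' mn mn'; rewrite !fm// subrr normr0.
Qed.

(** The bump passes through each point exactly once. Two bumps differ at two
points only, whereas the points that are still to be visited after time [m]
are infinite in number. *)
Definition moving_bump (n x : nat) : R := (n == x)%:R.

Lemma moving_bump_metastable :
  almost_uniform_metastable_cvg card moving_bump.
Proof.
apply: ae_cvg_metastable => [//|e n n' e0|].
  apply: counting_lty; apply: (@sub_finite_set _ _ [set n; n']) => [x /=|].
    rewrite /moving_bump; case: eqVneq => [|_]; first by left.
    case: eqVneq => [|_]; first by right.
    by rewrite subrr normr0 leNgt e0.
  by rewrite finite_setU; split; exact: finite_set1.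
apply: pointwise_ae_cvg => x; exists x.+1 => n xn.
by rewrite /moving_bump gtn_eqF.
Qed.

Lemma moving_bump_not_almost_uniform : ~ almost_uniform_cvg card moving_bump.
Proof.
move=> /(_ 1 1 ltr01 ltr01)[m]; apply/negP; rewrite -leNgt.
(* One bad point has measure 1, which already contradicts the bound [l = 1]. *)
apply: counting_ge1; exists m.
exists m, m.+1; split=> //.
by rewrite /moving_bump eqxx gtn_eqF// subr0 normr1.
Qed.

(** At [x] the sequence alternates between 0 and 1 until time [x] and is 0 from
then on: it converges everywhere, but the time of stabilization is unbounded. *)
Definition blinking (n x : nat) : R := (odd n && (n <= x)%N)%:R.

Lemma blinking_ae_cvg : ae_cvg card blinking.
Proof.
apply: pointwise_ae_cvg => x; exists x.+1 => n xn.
by rewrite /blinking leqNgt xn andbF.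
Qed.

(** With windows [[m, m + 1]], the point [M + 1] is unstable in all windows
starting at [m <= M], since it still alternates there. *)
Lemma blinking_not_metastable : ~ almost_uniform_metastable_cvg card blinking.
Proof.
move=> /(_ 1 1 S ltr01 ltr01)[M]; apply/negP; rewrite -leNgt.
apply: counting_ge1; exists M.+1 => m mM; exists m, m.+1.
rewrite !leqnn leqnSn; split=> //.
rewrite /blinking /= ltnS mM (leq_trans mM (leqnSn M)) !andbT.
by case: (odd m); rewrite /= ?subr0 ?sub0r ?normrN normr1.
Qed.

End CountingOnNat.

(** * The three modes of convergence compared *)

Theorem proposition4p1 (R : realType) :
  (forall (d : measure_display) (T : measurableType d)
      (mu : {measure set T -> \bar R}) (f : nat -> T -> R),
    (forall n, measurable_fun [set: T] (f n)) ->
    [/\ almost_uniform_cvg mu f -> almost_uniform_metastable_cvg mu f,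
        almost_uniform_metastable_cvg mu f -> ae_cvg mu f &
        (mu [set: T] = 1%E \/
         exists (p : R) (g : T -> R),
           [/\ 1 <= p, g \in Lfun mu p%:E & seq_dominated f g]) ->
        (almost_uniform_cvg mu f <-> almost_uniform_metastable_cvg mu f) /\
        (almost_uniform_metastable_cvg mu f <-> ae_cvg mu f)]) /\
  (forall (d : measure_display) (T : measurableType d)
      (mu : {measure set T -> \bar R}) (f : nat -> T -> R),
    (forall n, measurable_fun [set: T] (f n)) ->
    ((forall (e : R) (n n' : nat), 0 < e ->
        (mu [set x : T | (e <= `|f n x - f n' x|)%R] < +oo)%E) ->
      ae_cvg mu f -> almost_uniform_metastable_cvg mu f) /\
    ((exists p : R, 1 <= p /\ forall n, f n \in Lfun mu p%:E) ->
      ae_cvg mu f -> almost_uniform_metastable_cvg mu f)) /\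
  (exists (d : measure_display) (T : measurableType d)
      (mu : {measure set T -> \bar R}) (f : nat -> T -> R),
    [/\ forall n, measurable_fun [set: T] (f n),
        almost_uniform_metastable_cvg mu f & ~ almost_uniform_cvg mu f]) /\
  (exists (d : measure_display) (T : measurableType d)
      (mu : {measure set T -> \bar R}) (f : nat -> T -> R),
    [/\ forall n, measurable_fun [set: T] (f n),
        ae_cvg mu f & ~ almost_uniform_metastable_cvg mu f]).
Proof.
split; [|split; [|split]].
- move=> d T mu f mf; split.
  + exact: almost_uniform_metastable.
  + exact: metastable_ae_cvg.
  + move=> finf.
    have ae_au : ae_cvg mu f -> almost_uniform_cvg mu f.
      apply: ae_cvg_almost_uniform => // e e0.
      case: finf => [mu1|[p [g [p1 gp fg]]]].
        apply: le_lt_trans (ltry 1); rewrite -mu1.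
        by apply: le_measure; rewrite ?inE//; exact: measurable_tail_gap.
      exact (Lfun_dominated_tail_lty p1 mf gp fg e0).
    have au_aum := almost_uniform_metastable mf (mu := mu).
    have aum_ae := metastable_ae_cvg mf (mu := mu).
    split; split=> //; first by move=> /aum_ae/ae_au.
    by move=> /ae_au/au_aum.
- move=> d T mu f mf; split; first exact: ae_cvg_metastable.
  move=> [p [p1 fp]]; apply: ae_cvg_metastable => // e n n' e0.
  exact (Lfun_gap_lty p1 (fp n) (fp n') e0).
- exists _, nat, counting, moving_bump; split.
  + by [].
  + exact: moving_bump_metastable.
  + exact: moving_bump_not_almost_uniform.
- exists _, nat, counting, blinking; split.
  + by [].
  + exact: blinking_ae_cvg.
  + exact: blinking_not_metastable.
Qed.
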